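(* For every finite set $\mathcal{D}$ of finite directed graphs there is a finite set $\mathcal{F}$ of finite directed graphs such that $(\mathcal{F},\mathcal{D})$ is a generalized finite F-duality pair, i.e. for every finite directed graph $G$: there exists $F\in\mathcal{F}$ with a full homomorphism $F\to G$ if and only if there is no $D\in\mathcal{D}$ with a full homomorphism $G\to D$.
   Context: Directed graphs are finite, loops allowed (the empty graph is also allowed). A full homomorphism $f:G\to H$ is a map $f:V_G\to V_H$ such that $(u,v)\in E_G\iff (f(u),f(v))\in E_H$ for all $u,v\in V_G$. *)

(* Defs.v *)
From Stdlib Require List.
From mathcomp Require Import all_boot.

Set Implicit Arguments.
Unset Strict Implicit.
Unset Printing Implicit Defensive.

(* Loops are allowed, and the vertex type may be empty. *)
Record digraph := Digraph {
  vertex :> finType;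
  edge : rel vertex
}.

Arguments edge {G} : rename.

Definition full_hom (G H : digraph) (f : G -> H) : Prop :=
  forall u v : G, edge u v <-> edge (f u) (f v).

Definition has_full_hom (G H : digraph) : Prop :=
  exists f : G -> H, full_hom f.

(* Finite sets of digraphs are encoded as lists; membership is List.In because
   digraph is not an eqType. Order and multiplicity are irrelevant. *)
Definition generalized_full_duality_pair (Fs Ds : seq digraph) : Prop :=
  forall G : digraph,
    (exists F, List.In F Fs /\ has_full_hom F G) <->
    ~ (exists D, List.In D Ds /\ has_full_hom G D).

(* Main.v *)
(* A full homomorphism only identifies twins, i.e. vertices with the same in-
   and out-neighbours. Let M bound the orders of the targets. If G has at most
   M twin classes, a set of representatives is an equivalent graph of order at
   most M. Otherwise M+1 pairwise non-twin vertices, together with one vertex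
   separating each pair, already induce a graph without a full homomorphism
   to a target. Hence the obstructions of order at most (M+1) + (M+1)^2
   suffice. *)
Require Import Defs.
From mathcomp Require Import all_boot.

Set Implicit Arguments.
Unset Strict Implicit.
Unset Printing Implicit Defensive.

Lemma full_homE (G H : digraph) (f : G -> H) :
  full_hom f <-> forall u v : G, edge u v = edge (f u) (f v).
Proof.
split=> [fP u v|fP u v]; last by rewrite fP.
by apply/idP/idP => /fP.
Qed.

Lemma has_full_hom_trans (G H K : digraph) :
  has_full_hom G H -> has_full_hom H K -> has_full_hom G K.
Proof.
move=> [f /full_homE fP] [g /full_homE gP]; exists (g \o f).
by apply/full_homE => u v; rewrite fP gP.
Qed.

(** Ranging over finite functions makes existence decidable, so that obstructions can be filtered
    out of a finite enumeration. *)
Definition full_homb (G H : digraph) : bool :=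
  [exists f : {ffun G -> H},
    [forall u, forall v, edge u v == edge (f u) (f v)]].

Lemma full_hombP (G H : digraph) : reflect (has_full_hom G H) (full_homb G H).
Proof.
apply: (iffP existsP) => [[f /forallP fP]|[f /full_homE fP]].
  by exists f; apply/full_homE => u v; apply/eqP; move/forallP: (fP u).
exists (finfun f); apply/forallP => u; apply/forallP => v.
by rewrite !ffunE fP.
Qed.

(** [g] may repeat vertices: the copies are then twins, and [g] is still a full homomorphism. *)
Definition pullback (T : finType) (G : digraph) (g : T -> G) : digraph :=
  @Digraph T (relpre g edge).

Lemma pullback_full_hom (T : finType) (G : digraph) (g : T -> G) :
  has_full_hom (pullback g) G.
Proof. by exists g. Qed.

Lemma In_mem (T : eqType) (x : T) (s : seq T) : List.In x s <-> x \in s.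
Proof.
elim: s => //= y s IHs; rewrite inE; split=> [[->|/IHs ->]|].
- by rewrite eqxx.
- by rewrite orbT.
- by case/predU1P=> [->|/IHs]; [left | right].
Qed.

(** Up to isomorphism there are finitely many digraphs of order at most [N]. The list holds only
    copies on ordinals, so [P] is required at every [F'] that [F] maps to, in particular at its
    copy. *)
Lemma finite_small_digraphs (N : nat) (P : pred digraph) :
  exists Fs : seq digraph,
    (forall F, List.In F Fs -> P F) /\
    (forall F : digraph, #|F| <= N ->
      (forall F', has_full_hom F F' -> P F') ->
      exists F', List.In F' Fs /\ has_full_hom F' F).
Proof.
pose I := {n : 'I_N.+1 & {set 'I_n * 'I_n}}.
pose graph (i : I) :=
  @Digraph 'I_(tag i) (fun u v => (u, v) \in tagged i).
exists (List.map graph (enum [pred i | P (graph i)])); split=> [F|F leFN PF].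
  by case/List.in_map_iff=> i [<-] /In_mem; rewrite mem_enum.
pose i : I := @Tagged _ (Ordinal (leFN : #|F| < N.+1)) _
  [set uv : 'I_#|F| * 'I_#|F| | edge (enum_val uv.1) (enum_val uv.2)].
exists (graph i); split; last first.
  by exists enum_val; apply/full_homE => u v; rewrite /= inE.
apply/List.in_map_iff; exists i; split=> //; apply/In_mem.
rewrite mem_enum; apply: PF; exists enum_rank; apply/full_homE => u v.
by rewrite /= inE !enum_rankK.
Qed.

Lemma card_bounded (Ds : seq digraph) :
  exists M, forall D : digraph, List.In D Ds -> #|D| <= M.
Proof.
elim: Ds => [|D Ds [M leM]]; first by exists 0.
exists (maxn #|D| M) => E /= [<-|/leM leEM]; first exact: leq_maxl.
by rewrite leq_max leEM orbT.
Qed.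

Section Twins.

Variable G : digraph.

Definition separates (w u v : G) : bool :=
  (edge u w != edge v w) || (edge w u != edge w v).

Definition twin (u v : G) : bool := [forall w, ~~ separates w u v].

Lemma twinP (u v : G) :
  reflect (edge u =1 edge v /\ edge^~ u =1 edge^~ v) (twin u v).
Proof.
apply: (iffP forallP) => [uv|[uv vu] w]; last first.
  by rewrite /separates uv vu !eqxx.
by split=> w; have := uv w; rewrite /separates negb_or !negbK;
  case/andP => /eqP + /eqP.
Qed.

Lemma twin_refl (u : G) : twin u u.
Proof. exact/twinP. Qed.

Lemma twin_eq (u v : G) : twin u v -> twin u =1 twin v.
Proof.
move=> /twinP[uv vu] w; apply/twinP/twinP => -[uw wu]; split=> x.
- by rewrite -uv uw.
- by rewrite -vu wu.
- by rewrite uv uw.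
- by rewrite vu wu.
Qed.

Definition twin_repr (u : G) : G := odflt u [pick v | twin u v].

Lemma twin_reprP (u : G) : twin u (twin_repr u).
Proof. by rewrite /twin_repr; case: pickP => //= _; apply: twin_refl. Qed.

(** The result of [pick] depends only on the extension of the predicate, and twins have the same
    twin class. *)
Lemma eq_twin_repr (u v : G) : twin u v -> twin_repr u = twin_repr v.
Proof.
move=> uv; rewrite /twin_repr -(eq_pick (twin_eq uv)).
by case: pickP => // /(_ v); rewrite uv.
Qed.

Lemma twin_repr_sep (u v : G) :
  twin_repr u != twin_repr v ->
  exists w, separates w (twin_repr u) (twin_repr v).
Proof.
move=> neq_uv; apply/existsP; apply: contraNT neq_uv => /existsPn nsep.
have uv : twin (twin_repr u) (twin_repr v) by apply/forallP.
apply/eqP/eq_twin_repr.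
rewrite (twin_eq (twin_reprP u)) (twin_eq uv) -(twin_eq (twin_reprP v)).
exact: twin_refl.
Qed.

End Twins.

(** [F] has bounded order and maps to the same digraphs of order at most [M] as [G] does. *)
Lemma small_obstruction (G : digraph) (M : nat) :
  exists F : digraph, [/\ #|F| <= M.+1 + M.+1 * M.+1, has_full_hom F G &
    forall D : digraph, #|D| <= M -> has_full_hom F D -> has_full_hom G D].
Proof.
pose R := [set twin_repr u | u : G].
have [leRM|ltMR] := leqP #|R| M.
  exists (pullback (enum_val : 'I_#|R| -> G)); split.
  - by rewrite card_ord (leq_trans leRM) // (leq_trans (leqnSn M)) ?leq_addr.
  - exact: pullback_full_hom.
  - move=> D _; apply: has_full_hom_trans.
    have inR (u : G) : twin_repr u \in R by apply: imset_f.
    (* Retract [G] onto the representatives; replacing both ends of a pair by twins preserves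
       adjacency. *)
    exists (fun u => enum_rank_in (inR u) (twin_repr u)).
    apply/full_homE => u v; rewrite /= !enum_rankK_in //.
    have /twinP[uE _] := twin_reprP u; have /twinP[_ vE] := twin_reprP v.
    by rewrite uE vE.
pose a (i : 'I_M.+1) : G := enum_val (widen_ord ltMR i).
have a_sep i j : i != j -> exists w, separates w (a i) (a j).
  move=> neq_ij; have: a i != a j.
    by apply: contraNneq neq_ij => /enum_val_inj/(congr1 val)/= /val_inj ->.
  have /imsetP[u _ ->] : a i \in R by apply: enum_valP.
  have /imsetP[v _ ->] : a j \in R by apply: enum_valP.
  exact: twin_repr_sep.
(* The default is taken only for [i = j], where nothing separates. *)
pose wit i j := odflt (a i) [pick w | separates w (a i) (a j)].
have witP i j : i != j -> separates (wit i j) (a i) (a j).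
  move=> /a_sep[w aw]; rewrite /wit; case: pickP => //= /(_ w).
  by rewrite aw.
pose g (x : 'I_M.+1 + 'I_M.+1 * 'I_M.+1) : G :=
  match x with inl i => a i | inr ij => wit ij.1 ij.2 end.
exists (pullback g); split.
- by rewrite card_sum card_prod card_ord.
- exact: pullback_full_hom.
move=> D leDM [f /full_homE fP].
(* By pigeonhole, [M.+1] distinct images do not fit into [D]. *)
suff f_inj : injective (fun i : 'I_M.+1 => f (inl i)).
  by have := leq_trans (leq_card _ f_inj) leDM; rewrite card_ord ltnn.
(* If [f] identified two of these vertices, fullness would make them agree on their witness, which
   separates them. *)
move=> i j /= eq_f; apply/eqP; apply/negPn/negP => /witP.
have := fP (inl i) (inr (i, j)); have := fP (inr (i, j)) (inl i).
rewrite eq_f -!fP /= => eq_in eq_out.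
by rewrite /separates eq_in eq_out !eqxx.
Qed.

Theorem theorem5p5p7 (Ds : seq digraph) :
  exists Fs : seq digraph, generalized_full_duality_pair Fs Ds.
Proof.
have [M leM] := card_bounded Ds.
pose obstruction F := ~~ List.existsb (full_homb F) Ds.
have obstructionP F :
    obstruction F <-> ~ exists D, List.In D Ds /\ has_full_hom F D.
  split=> [/negP nF [D [inD FD]]|nF].
    by apply: nF; apply/List.existsb_exists; exists D; split=> //; apply/full_hombP.
  apply/negP => /List.existsb_exists[D [inD /full_hombP FD]].
  by apply: nF; exists D.
have [Fs [Fs_obs Fs_small]] :=
  finite_small_digraphs (M.+1 + M.+1 * M.+1) obstruction.
exists Fs => G; split=> [[F [/Fs_obs/obstructionP nF FG]] [D [inD GD]]|nG].
  by apply: nF; exists D; split=> //; apply: has_full_hom_trans FG GD.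
have [F [leF FG F_obs]] := small_obstruction G M.
(* Being an obstruction passes from [F] to any [F'] it maps to: composing with a map from [F'] to
   some [D] would yield one from [G] to [D]. *)
have [F' FF'|F' [inF' F'F]] := Fs_small F leF.
  apply/obstructionP => -[D [inD F'D]]; apply: nG; exists D; split=> //.
  by apply: F_obs (leM _ inD) _; apply: has_full_hom_trans FF' F'D.
by exists F'; split=> //; apply: has_full_hom_trans F'F FG.
Qed.
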